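(* Suppose $C$ is a constant such that $C^2 \geq \sup\limits_{1\leq k\leq n} \left|\frac {p_k}{q_k}\right|\cdot \frac 1{\cos 2\theta}$, where $p_k, q_k, z \in S_{\theta}$ with $0\leq \theta < \pi/4$ and $p_k, q_k \neq 0$. If $|z|\leq C$ then \begin{equation*} \left|\cfrac{1}{q_1+\cfrac{1}{p_1+\cfrac{1}{q_2+\cfrac{1}{p_2+\cdots+\cfrac{1}{q_n+\cfrac{1}{p_n+z}}}}}}\right| \leq C. \end{equation*}
   Context: For $0\leq\theta<\pi/2$, $S_{\theta}=\{z\in\mathbb{C}:|\mathrm{Arg}\,z|\leq\theta\}$ denotes the closed sector of half-angle $\theta$ about the positive real axis. The expression in the claim is the finite continued fraction $\cfrac{1}{q_1+\cfrac{1}{p_1+\cdots}}$ with partial numerators all equal to $1$ and partial denominators $q_1,p_1,q_2,p_2,\dots,q_n,p_n+z$ in this order. *)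

(* Defs.v *)
From mathcomp Require Import all_boot all_order all_algebra.
From mathcomp Require Import all_classical all_reals all_analysis.
From mathcomp Require Import complex.

Set Implicit Arguments.
Unset Strict Implicit.
Unset Printing Implicit Defensive.

Import Order.TTheory GRing.Theory Num.Theory.

Local Open Scope ring_scope.
Local Open Scope complex_scope.

(* The R-valued modulus (Num.norm on R[i] takes its values in R[i]). *)
Notation cmod := ComplexField.Normc.normc.

(* Principal argument, in ]-pi, pi], characterized by [Arg_bound] and
   [Arg_polar]. The convention Arg 0 = 0 puts the vertex 0 in every sector. *)
Definition Arg (R : realType) (z : R[i]) : R :=
  if z == 0 then 0
  else if 0 <= complex.Im z then acos (complex.Re z / cmod z)
  else - acos (complex.Re z / cmod z).

Definition sector (R : realType) (theta : R) : set R[i] :=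
  [set z | `|Arg z| <= theta]%classic.

(* The innermost step (k = n) is 1 / (q_n + 1 / (p_n + z)). *)
Definition cfrac (R : realType) (q p : nat -> R[i]) (n : nat) (z : R[i])
    : R[i] :=
  foldr (fun k t => 1 / (q k + 1 / (p k + t))) z (iota 1 n).

Section ArgTheory.
Variable R : realType.
Implicit Types z : R[i].

Lemma cmod_gt0 z : z != 0 -> 0 < cmod z.
Proof.
case: z => a b z0; rewrite lt_def sqrtr_ge0 andbT.
by apply: contra z0 => /eqP/ComplexField.Normc.eq0_normc ->.
Qed.

Lemma sqr_cmod z : cmod z ^+ 2 = complex.Re z ^+ 2 + complex.Im z ^+ 2.
Proof. by case: z => a b /=; rewrite sqr_sqrtr// addr_ge0 ?sqr_ge0. Qed.

Lemma Re_cmod_bound z : z != 0 -> -1 <= complex.Re z / cmod z <= 1.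
Proof.
move=> /cmod_gt0 z0; rewrite -ler_norml normrM normfV (gtr0_norm z0).
rewrite ler_pdivrMr// mul1r -(ger0_norm (ltW z0)) -ler_sqr ?nnegrE//.
by rewrite !real_normK ?num_real// sqr_cmod lerDl sqr_ge0.
Qed.

Lemma sin_acos_cmod z : z != 0 ->
  sin (acos (complex.Re z / cmod z)) = `|complex.Im z| / cmod z.
Proof.
move=> z0; have m0 := cmod_gt0 z0.
rewrite sin_acos ?Re_cmod_bound//.
have -> : 1 - (complex.Re z / cmod z) ^+ 2 = (complex.Im z / cmod z) ^+ 2.
  rewrite !exprMn !exprVn.
  rewrite -[X in X - _](@divff _ (cmod z ^+ 2)) ?expf_neq0 ?gt_eqF//.
  by rewrite -mulrBl {1}sqr_cmod addrC addKr.
by rewrite sqrtr_sqr normrM normfV (gtr0_norm m0).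
Qed.

Lemma Arg_polar z : z = (cmod z * cos (Arg z)) +i* (cmod z * sin (Arg z)).
Proof.
rewrite /Arg; have [->|z0] := eqVneq z 0.
  by rewrite ComplexField.Normc.normc0 !mul0r.
have m0 : cmod z != 0 by rewrite gt_eqF ?cmod_gt0.
have cK : cos (acos (complex.Re z / cmod z)) = complex.Re z / cmod z.
  by rewrite acosK// in_itv/= Re_cmod_bound.
case: ifPn => [im|]; last rewrite -ltNge => im.
  rewrite cK sin_acos_cmod// (ger0_norm im) !mulrA ![cmod z * _]mulrC !mulfK//.
  by case: z {z0 m0 cK im}.
rewrite cosN sinN cK sin_acos_cmod// (ltr0_norm im) -mulNr opprK.
rewrite !mulrA ![cmod z * _]mulrC !mulfK//.
by case: z {z0 m0 cK im}.
Qed.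

Lemma Arg_bound z : - pi < Arg z <= pi.
Proof.
have pi0 : 0 < pi :> R by exact: pi_gt0.
rewrite /Arg; have [_|z0] := eqVneq z 0; first by rewrite oppr_lt0 pi0 ltW.
have b := Re_cmod_bound z0.
have a0 := acos_ge0 b; have api := acos_lepi b.
case: ifPn => [_|]; first by rewrite api andbT (lt_le_trans _ a0)// oppr_lt0.
rewrite -ltNge => im; apply/andP; split; last first.
  by rewrite (le_trans _ (ltW pi0))// oppr_le0.
rewrite ltrN2 lt_neqAle api andbT; apply/negP => /eqP e.
have := sin_acos_cmod z0; rewrite e sinpi => /esym/eqP.
by rewrite mulf_eq0 invr_eq0 normr_eq0 (lt_eqF im) (gt_eqF (cmod_gt0 z0)).
Qed.

End ArgTheory.

(* Main.v *)
Require Import Defs.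
From mathcomp Require Import all_boot all_order all_algebra.
From mathcomp Require Import all_classical all_reals all_analysis.
From mathcomp Require Import complex.
From mathcomp Require Import ring lra.

Import Order.TTheory GRing.Theory Num.Theory.

Local Open Scope classical_set_scope.
Local Open Scope ring_scope.

(** With [u = p + t], one step of the continued fraction is the map
    [t |-> u / (1 + q u)], which preserves the sector. Since [q] and [u] have
    arguments at most [theta], [Re (q u) >= |q| |u| cos (2 theta)], so
    [|1 + q u|^2 >= 1 + 2 |q| |u| cos (2 theta)]; on the other hand
    [|u| <= |p| + |t| <= C^2 |q| cos (2 theta) + C]. Completing the square in
    [|u|] gives [|u|^2 <= C^2 |1 + q u|^2]. *)

(* For [c = cos theta] and [0 <= theta < pi / 2] this is the sector of
   half-angle [theta]. *)
Definition cone {R : realType} (c : R) (z : R[i]) : Prop :=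
  cmod z * c <= complex.Re z.

Section Cone.
Context {R : realType}.
Implicit Types (c C theta : R) (z u : R[i]).

Lemma cmod_ge0 z : 0 <= cmod z.
Proof. by case: z => a b; exact: sqrtr_ge0. Qed.

(** The real part is [cmod z * cos (Arg z)], and cosine is even and decreasing on [[0, pi]]. *)
Lemma sector_cone theta z : theta <= pi -> sector theta z -> cone (cos theta) z.
Proof.
move=> th_pi zth; have th0 : 0 <= theta by exact: le_trans zth.
rewrite /cone {2}[z]Arg_polar /=; apply: ler_wpM2l; first exact: cmod_ge0.
rewrite -(cos_norm (Arg z)) leNgt ltr_cos ?in_itv/= ?th0 ?th_pi//.
- by rewrite -leNgt.
- by rewrite normr_ge0 (le_trans zth).
Qed.

Lemma coneD c z u : 0 <= c -> cone c z -> cone c u -> cone c (z + u).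
Proof.
move=> c0 zc uc; apply: (@le_trans _ _ ((cmod z + cmod u) * c)).
  by rewrite ler_wpM2r// le_normcD.
by rewrite mulrDl raddfD lerD.
Qed.

(** Inversion is conjugation followed by division by [cmod z ^+ 2], so the ratio of real part to
    modulus is unchanged. *)
Lemma coneV c z : cone c z -> cone c z^-1.
Proof.
have [->|z0] := eqVneq z 0; first by rewrite invr0.
have m0 := cmod_gt0 z0.
rewrite /cone ComplexField.Normc.normcV => zc.
have -> : complex.Re z^-1 = complex.Re z / cmod z ^+ 2.
  by rewrite sqr_cmod; case: (z).
rewrite ler_pdivlMr ?exprn_gt0//.
by have -> : (cmod z)^-1 * c * cmod z ^+ 2 = cmod z * c by field; rewrite gt_eqF.
Qed.

Lemma cone_Re_gt0 c z : 0 < c -> cone c z -> z != 0 -> 0 < complex.Re z.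
Proof. by move=> c0 zc /cmod_gt0 z0; rewrite (lt_le_trans _ zc)// mulr_gt0. Qed.

Lemma cone_Im_sqr c z : 0 <= c -> cone c z ->
  complex.Im z ^+ 2 <= cmod z ^+ 2 * (1 - c ^+ 2).
Proof.
move=> c0 zc; have m0 := cmod_ge0 z.
have : (cmod z * c) ^+ 2 <= complex.Re z ^+ 2.
  by rewrite ler_sqr ?nnegrE ?mulr_ge0// (le_trans _ zc) ?mulr_ge0.
by have := sqr_cmod z; rewrite exprMn; lra.
Qed.

(** For [c = cos theta] the factor is [cos (2 theta)]: the product of real parts contributes at
    least [c ^+ 2], that of imaginary parts takes away at most [1 - c ^+ 2], the square of the
    sine. *)
Lemma cone_ReM c z u : 0 <= c <= 1 -> cone c z -> cone c u ->
  cmod z * cmod u * (c ^+ 2 *+ 2 - 1) <= complex.Re (z * u).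
Proof.
move=> /andP[c0 c1] zc uc.
have z0 := cmod_ge0 z; have u0 := cmod_ge0 u.
have d0 : 0 <= 1 - c ^+ 2 by rewrite subr_ge0 expr_le1.
have ImM : complex.Im z * complex.Im u <= cmod z * cmod u * (1 - c ^+ 2).
  rewrite (le_trans (ler_norm _))// -ler_sqr ?nnegrE ?mulr_ge0//.
  rewrite real_normK ?num_real//.
  have -> : (cmod z * cmod u * (1 - c ^+ 2)) ^+ 2 =
      (cmod z ^+ 2 * (1 - c ^+ 2)) * (cmod u ^+ 2 * (1 - c ^+ 2)) by ring.
  by rewrite exprMn ler_pM ?sqr_ge0// cone_Im_sqr.
have ReM : cmod z * c * (cmod u * c) <= complex.Re z * complex.Re u.
  by rewrite ler_pM ?mulr_ge0.
have -> : complex.Re (z * u) =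
    complex.Re z * complex.Re u - complex.Im z * complex.Im u.
  by case: (z) (u) => [a b] [a' b'].
by nra.
Qed.

Lemma sqr_cmod1D z : cmod (1 + z) ^+ 2 = 1 + complex.Re z *+ 2 + cmod z ^+ 2.
Proof. by rewrite !sqr_cmod; case: z => a b /=; ring. Qed.

Lemma cone_step c C (p q t : R[i]) : 0 < c <= 1 -> 0 <= C ->
    cone c p -> p != 0 -> cone c q -> cone c t ->
    cmod p <= cmod q * C ^+ 2 * (c ^+ 2 *+ 2 - 1) -> cmod t <= C ->
  cone c (1 / (q + 1 / (p + t))) /\ cmod (1 / (q + 1 / (p + t))) <= C.
Proof.
move=> /andP[c0 c1] C0 pc p0 qc tc pq tC; rewrite !div1r.
have c0' := ltW c0; set u := p + t.
have uc : cone c u by exact: coneD.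
have Vc : cone c (q + u^-1) by apply: coneD => //; exact: coneV.
split; first exact: coneV.
have Ret : 0 <= complex.Re t by rewrite (le_trans _ tc)// mulr_ge0 ?cmod_ge0.
have u0 : u != 0.
  apply/eqP => /(congr1 (@complex.Re R)) /= /eqP.
  by rewrite raddfD gt_eqF// ltr_wpDr// (cone_Re_gt0 c p).
set k := c ^+ 2 *+ 2 - 1 in pq.
have uC : cmod u <= C + C ^+ 2 * cmod q * k.
  by rewrite (le_trans (le_normcD _ _))// addrC lerD// (mulrC (C ^+ 2)).
have Requ : cmod q * cmod u * k <= complex.Re (q * u).
  by apply: cone_ReM; rewrite ?c0'.
have m1 := sqr_cmod1D (q * u).
have u1 := cmod_ge0 u; have q1 := cmod_ge0 q.
have main : cmod u ^+ 2 <= C ^+ 2 * cmod (1 + q * u) ^+ 2.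
  rewrite m1.
  have : C ^+ 2 * (1 + cmod q * cmod u * k *+ 2) <=
      C ^+ 2 * (1 + complex.Re (q * u) *+ 2 + cmod (q * u) ^+ 2).
    apply: ler_wpM2l; first exact: sqr_ge0.
    by have := sqr_ge0 (cmod (q * u)); lra.
  apply: le_trans.
  set s := C ^+ 2 * cmod q * k in uC.
  have -> : C ^+ 2 * (1 + cmod q * cmod u * k *+ 2) = C ^+ 2 + s * cmod u *+ 2.
    by rewrite /s; ring.
  (* If [cmod u <= s], then [cmod u ^+ 2 <= s * cmod u]. Otherwise [0 < cmod u - s <= C], and
     squaring gives the bound. *)
  by have [us|us] := lerP (cmod u) s; nra.
have cu := cmod_gt0 u0.
(* If [1 + q * u] vanished, [main] would force [u = 0]. *)
have m0 : 0 < cmod (1 + q * u).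
  rewrite lt_def cmod_ge0 andbT; apply/eqP => m0.
  by move: main; rewrite m0 expr0n mulr0 leNgt exprn_gt0.
have -> : q + u^-1 = (1 + q * u) / u by field.
rewrite invf_div ComplexField.Normc.normcM ComplexField.Normc.normcV.
by rewrite ler_pdivrMr// -ler_sqr ?nnegrE ?mulr_ge0// ?exprMn// ltW.
Qed.

(** Induction from the innermost tail outwards. The list is arbitrary because the tail of [iota 1 n]
    no longer starts at 1; cone membership is carried along since [cone_step] asks it of [t]. *)
Lemma cfrac_cone c C (p q : nat -> R[i]) (s : seq nat) z :
    0 < c <= 1 -> 0 <= C ->
    {in s, forall k, [/\ cone c (p k), p k != 0, cone c (q k) &
      cmod (p k) <= cmod (q k) * C ^+ 2 * (c ^+ 2 *+ 2 - 1)]} ->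
    cone c z -> cmod z <= C ->
  let w := foldr (fun k t => 1 / (q k + 1 / (p k + t))) z s in
  cone c w /\ cmod w <= C.
Proof.
move=> c01 C0 + zc zC; elim: s => [//|k s IH] /= pqs.
have [|wc wC] := IH; first by move=> j js; apply: pqs; rewrite inE js orbT.
have [pc p0 qc pq] := pqs k (mem_head _ _).
exact: cone_step.
Qed.

End Cone.

Lemma le_sup_nat_image (R : realType) (f : nat -> R) (m n k : nat) :
  (m <= k <= n)%N -> f k <= sup [set f j | j in [set j | (m <= j <= n)%N]].
Proof.
move=> mkn; apply: ub_le_sup; last by exists k.
(* [sup] dominates its set only if that set is bounded above; this sum bounds every [f j] with
   [j <= n]. *)
exists (\sum_(j < n.+1) `|f j|) => _ [j /= /andP[_ jn] <-].
rewrite -ltnS in jn.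
rewrite (bigD1 (Ordinal jn))//= (le_trans (ler_norm _))// lerDl.
by apply: sumr_ge0 => i _; exact: normr_ge0.
Qed.

Theorem theorem2p3 (R : realType) (theta C : R) (n : nat)
    (p q : nat -> R[i]) (z : R[i])
    (hn : (1 <= n)%N)
    (htheta : 0 <= theta < pi / 4)
    (hp : forall k : nat, (1 <= k <= n)%N -> sector theta (p k) /\ p k <> 0)
    (hq : forall k : nat, (1 <= k <= n)%N -> sector theta (q k) /\ q k <> 0)
    (hz : sector theta z)
    (hC : sup [set cmod (p k / q k) | k in [set k : nat | (1 <= k <= n)%N]]
            * (1 / cos (2 * theta)) <= C ^+ 2) :
  cmod z <= C -> cmod (cfrac q p n z) <= C.
Proof.
move=> zC; have C0 : 0 <= C by rewrite (le_trans (cmod_ge0 z)).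
case/andP: htheta => th0 thpi; have pi0 := pi_gt0 R.
have thpi1 : theta <= pi by lra.
have c0 : 0 < cos theta by apply: cos_gt0_pihalf; apply/andP; split; lra.
have c20 : 0 < cos (2 * theta) by apply: cos_gt0_pihalf; apply/andP; split; lra.
apply: (@cfrac_cone R (cos theta) C p q (iota 1 n) z _ C0 _ _ zC).2.
- by rewrite c0 cos_le1.
- move=> k; rewrite mem_iota add1n ltnS => kn.
  have [pk /eqP pk0] := hp k kn; have [qk /eqP qk0] := hq k kn.
  split => //; [exact: sector_cone|exact: sector_cone|].
  (* By the double-angle formula the factor is [cos (2 * theta)], positive as [theta < pi / 4].
     Dividing by it and by [cmod (q k)] leaves a bound on [cmod (p k / q k)] that follows from
     [hC]. *)
  rewrite -cos_mulr2n -mulr_natl -mulrA mulrC -ler_pdivrMr ?cmod_gt0//.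
  rewrite -ComplexField.Normc.normcV -ComplexField.Normc.normcM.
  rewrite -ler_pdivrMr//; apply: le_trans hC.
  rewrite div1r ler_pM2r ?invr_gt0//.
  exact: (@le_sup_nat_image R (fun k => cmod (p k / q k))).
- exact: sector_cone.
Qed.
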